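(* Let $k \geq 1$ be an integer and let $G$ be an edge-coloured graph on $n$ vertices with $\delta^c(G) \geq k$. If either $k \geq 4$ and $n \geq 4k-4$, or $k \leq 3$ and $n \geq 4k-3$, then $G$ contains a rainbow matching of size $k$.
   Context: All graphs are simple (no loops or multiple edges). An edge-coloured graph is a graph in which each edge is assigned a colour; the colouring need not be proper (adjacent edges may share a colour). A subgraph is rainbow if all its edges have distinct colours. The colour degree of a vertex $v$ is the number of distinct colours on the edges incident with $v$, and $\delta^c(G)$ denotes the minimum colour degree over all vertices of $G$. A matching of size $k$ is a set of $k$ pairwise vertex-disjoint edges. *)

(* Defs.v *)
From mathcomp Require Import all_boot.

Set Implicit Arguments.
Unset Strict Implicit.
Unset Printing Implicit Defensive.

(* An edge is a 2-element set of vertices.  The colouring is a total function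
   on {set T} for convenience: only its values on [edges G] are ever used.
   It is not required to be proper. *)
Record ecgraph (T : finType) (C : eqType) := ECGraph {
  edges : {set {set T}};
  colour : {set T} -> C;
  edges_card2 : forall e, e \in edges -> #|e| = 2
}.

Section EdgeColouredGraph.
Variables (T : finType) (C : eqType) (G : ecgraph T C).

Definition colours_at (v : T) : seq C :=
  undup [seq colour G e | e : {set T} <- enum (edges G) & v \in e].

Definition colour_degree (v : T) : nat := size (colours_at v).

(* A colour degree is at most #|T| - 1, so the default value #|T| never
   affects the minimum when T is nonempty. *)
Definition min_colour_degree : nat :=
  \big[minn/#|T|]_(v : T) colour_degree v.

Definition matching (M : {set {set T}}) : Prop :=
  M \subset edges G /\ trivIset M.

Definition rainbow (M : {set {set T}}) : Prop :=
  {in M &, injective (colour G)}.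

End EdgeColouredGraph.

(* Main.v *)
Require Import Defs.
From mathcomp Require Import all_boot zify.

Set Implicit Arguments.
Unset Strict Implicit.
Unset Printing Implicit Defensive.

(* Let m = k - 1 and suppose that every matching has at most m colours.  By
   induction on k there are matchings with exactly m colours in which each
   colour occurs at most twice; let E be a largest one, s the number of colours
   it uses once, and W the set of vertices that E misses.  Process the vertices
   w of W one at a time, maintaining a set A of edges of E whose colours occur
   once in E, such that each e in A can be removed by an alternating exchange
   that uses only processed vertices and frees one end of e.  The vertex w has
   at least |A| + 1 colours that do not occur on E \ A.  An edge at w with such
   a colour cannot lead outside E, nor to a freed end of an edge of A, without
   contradicting the choice of m or of E; so some such edge leads to an edge of
   E \ A, which joins A.  Hence |W| <= s, and |E| <= 2m - s gives
   n <= 4m - s.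

   If n = 4m, then E is perfect and uses every colour exactly twice.  In the
   four vertices spanned by the two edges of one colour there are two disjoint
   edges of a common colour outside E; exchanging them frees the first colour,
   which therefore cannot occur between different quadruples.  So all edges lie
   inside quadruples, and all degrees are at most 3. *)

(** * Matchings, colour multiplicities and rainbow submatchings *)

Section Matchings.
Variables (T K : finType) (H : {set {set T}}) (col : {set T} -> K).
Hypothesis H2 : forall e, e \in H -> #|e| = 2.
Implicit Types (E F A : {set {set T}}) (e f : {set T}).

Definition is_matching E := (E \subset H) && trivIset E.
Definition mult c E := #|[set e in E | col e == c]|.
Definition cdeg v := #|col @: [set e in H | v \in e]|.

Lemma is_matching_edge E e : is_matching E -> e \in E -> e \in H.
Proof. by case/andP=> /subsetP sE _ /sE. Qed.

Lemma is_matching_sub E F : F \subset E -> is_matching E -> is_matching F.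
Proof.
move=> sFE /andP[sE tE]; rewrite /is_matching (subset_trans sFE sE) /=.
exact: trivIsetS tE.
Qed.

Lemma is_matching_add E f :
  is_matching E -> f \in H -> [disjoint f & cover E] -> is_matching (f |: E) /\ f \notin E.
Proof.
move=> mE fH dis; case/andP: (mE) => sE tE.
have d e : e \in E -> [disjoint f & e].
  by move=> eE; apply: disjointWr dis; apply: bigcup_sup.
have n0 : set0 \notin E.
  by apply/negP=> /(is_matching_edge mE)/H2; rewrite cards0.
have [t nf] := trivIsetU1 d tE n0.
by split=> //; rewrite /is_matching t subUset sub1set fH sE.
Qed.

Lemma is_matching_uniq E e f x :
  is_matching E -> e \in E -> f \in E -> x \in e -> x \in f -> e = f.
Proof.
case/andP=> _ /trivIsetP t eE fE xe xf; apply/eqP; apply: contraT => /(t _ _ eE fE).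
by move/disjoint_setI0/setP/(_ x); rewrite !inE xe xf.
Qed.

Lemma cover_D1 E e x : is_matching E -> e \in E -> x \in e -> x \notin cover (E :\ e).
Proof.
move=> mE eE xe; apply/negP=> /bigcupP[f /setD1P[nfe fE] xf].
by rewrite (is_matching_uniq mE fE eE xf xe) eqxx in nfe.
Qed.

Lemma cover_sub E F : E \subset F -> cover E \subset cover F.
Proof. by move=> s; apply/bigcupsP=> e eE; apply: bigcup_sup; apply: (subsetP s). Qed.

Lemma edge_pair f w : f \in H -> w \in f ->
  exists2 u, u != w & f = [set w; u].
Proof.
move=> /H2/eqP/cards2P[x [y [nxy ->]]]; rewrite !inE => /orP[]/eqP->.
  by exists y => //; rewrite eq_sym.
by exists x => //; rewrite setUC.
Qed.

Lemma disjoint_pair (w u : T) (X : {set T}) :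
  w \notin X -> u \notin X -> [disjoint [set w; u] & X].
Proof.
move=> wX uX; rewrite -setI_eq0; apply/eqP/setP=> z; rewrite !inE.
by apply/negP=> /andP[/orP[]/eqP-> h]; rewrite h in wX uX.
Qed.

Lemma mult_eq0 c E : (mult c E == 0) = (c \notin col @: E).
Proof.
apply/idP/idP.
  rewrite cards_eq0 => /eqP/setP h; apply/imsetP=> -[e eE ce].
  by move: (h e); rewrite !inE eE ce eqxx.
move=> h; rewrite cards_eq0; apply/eqP/setP=> e; rewrite !inE.
by apply/negP=> /andP[eE /eqP ce]; case/negP: h; rewrite -ce imset_f.
Qed.

Lemma mult_uniq e E : e \in E -> {in E, forall f, col f = col e -> f = e} ->
  mult (col e) E = 1.
Proof.
move=> eE u; rewrite -(cards1 e); congr #|pred_of_set _|; apply/setP=> f; rewrite !inE.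
apply/andP/eqP=> [[fE /eqP]|->]; last by rewrite eE.
exact: u.
Qed.

Lemma mult_sub c E F : E \subset F -> mult c E <= mult c F.
Proof.
move=> s; apply/subset_leq_card/subsetP=> e; rewrite !inE => /andP[eE ->].
by rewrite (subsetP s).
Qed.

Lemma mult_add c f E : f \notin E -> mult c (f |: E) = (col f == c) + mult c E.
Proof.
move=> nf; rewrite /mult; case: eqP => h /=.
  rewrite (_ : [set e in f |: E | _] = f |: [set e in E | col e == c]).
    by rewrite cardsU1 inE (negPf nf).
  apply/setP=> e; rewrite !inE; case: eqP => //= ->; by rewrite h eqxx.
rewrite add0n; congr #|pred_of_set _|; apply/setP=> e; rewrite !inE.
by case: eqP => //= ->; rewrite (negPf nf); apply/eqP.
Qed.

Lemma card_le_mult E : (forall c, mult c E <= 2) -> #|E| <= 2 * #|col @: E|.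
Proof.
move=> h; rewrite -sum1_card (partition_big_imset col) /= mulnC -sum_nat_const.
apply: leq_sum => c _; apply: leq_trans (h c).
rewrite sum1_card; apply: eq_leq; apply: eq_card => e; rewrite !inE //.
Qed.

Lemma rainbow_sub E m : m <= #|col @: E| ->
  exists F, [/\ F \subset E, {in F &, injective col} & #|F| = m].
Proof.
move=> le.
pose D := [set c in take m (enum (col @: E))].
have cD : #|D| = m.
  rewrite cardsE; have /card_uniqP -> : uniq (take m (enum (col @: E))).
    by rewrite take_uniq ?enum_uniq.
  by rewrite size_takel // -cardE.
have sD c : c \in D -> c \in col @: E.
  by rewrite inE => /mem_take; rewrite mem_enum.
(* [g] picks one edge of [E] for each colour; the default [set0] is never reached on [D], whose
   colours all occur in [E]. *)
pose g c := odflt set0 [pick e in E | col e == c].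
have gP c : c \in D -> g c \in E /\ col (g c) = c.
  move=> /sD/imsetP[e eE ->]; rewrite /g; case: pickP => [f /andP[fE /eqP]|/(_ e)] //=.
  by rewrite eE eqxx.
exists (g @: D); split.
- by apply/subsetP=> e /imsetP[c /gP[? _] ->].
- move=> e f /imsetP[c cD' ->] /imsetP[d dD ->].
  by case: (gP _ cD') => _ ->; case: (gP _ dD) => _ ->  ->.
- rewrite card_in_imset // => c d /gP[_ {2}<-] /gP[_ {2}<-] -> //.
Qed.

End Matchings.

(** * Exchanges in matchings with the maximum number of colours *)

Section Augment.
Variables (T K : finType) (H : {set {set T}}) (col : {set T} -> K) (m : nat).
Hypothesis H2 : forall e, e \in H -> #|e| = 2.
Local Notation is_matching := (is_matching H).
Local Notation mult := (mult col).
Hypothesis few : forall E, is_matching E -> #|col @: E| <= m.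
Hypothesis deg : forall v, m < cdeg H col v.
Implicit Types (E F A : {set {set T}}) (e f : {set T}).

(** The cap of two on multiplicities bounds [#|E|] by [2 * m], so the size of a largest such
    matching controls the order of the graph. *)
Definition valid E := [&& is_matching E, #|col @: E| == m & [forall c, mult c E <= 2]].

Lemma validP E : reflect [/\ is_matching E, #|col @: E| = m & forall c, mult c E <= 2]
  (valid E).
Proof.
by apply: (iffP and3P) => -[a /eqP b /forallP c].
Qed.

Lemma full_colour E f : is_matching (f |: E) -> #|col @: E| = m -> col f \in col @: E.
Proof.
move=> /few; rewrite imsetU1 cardsU1 => h c; move: h; rewrite c.
by case: (_ \in _) => //=; rewrite add1n ltnn.
Qed.

(* The colour of e is lost because adding f to F creates colour number m + 1,
   which the matching F' cannot retain. *)
Lemma exchange F e f w u : valid F -> e \in F -> f \in H -> f = [set w; u] ->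
  u \in e -> w \notin cover F -> col f \notin col @: F ->
  let F' := f |: (F :\ e) in
  [/\ valid F', #|F'| = #|F|, col e \notin col @: F' & 
      forall c, mult c F' <= maxn 1 (mult c F)].
Proof.
move=> /validP[mF cF m2] eF fH def ue wF nf F'.
have mFe : is_matching (F :\ e) by apply: is_matching_sub mF; apply: subD1set.
have wFe : w \notin cover (F :\ e).
  by apply: contra wF; apply: subsetP (cover_sub _) _; apply: subD1set.
have [mF' nfF]: is_matching F' /\ f \notin F :\ e.
  apply: is_matching_add => //; rewrite def disjoint_pair //.
  exact: cover_D1 mF eF ue.
have nfc : col f \notin col @: (F :\ e).
  apply: contra nf; apply: subsetP (imsetS _ _) _; exact: subD1set.
have cF' : #|col @: F'| = #|col @: (F :\ e)|.+1.
  by rewrite imsetU1 cardsU1 nfc.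
have cE : col @: F = col e |: col @: (F :\ e) by rewrite -imsetU1 setD1K.
have := few mF'; rewrite cF' -cF cE cardsU1 => lt.
have nec : col e \notin col @: (F :\ e) by move: lt; case: (_ \in _) => //=; rewrite add0n ltnn.
have mb c : mult c F' <= maxn 1 (mult c F).
  rewrite mult_add //; case: eqP => [<-|_] /=.
    by move: nfc; rewrite -mult_eq0 => /eqP->; rewrite addn0 leq_maxl.
  by rewrite add0n leq_max mult_sub ?orbT // subD1set.
split=> //.
- apply/validP; split=> //; first by rewrite cF' -cF cE cardsU1 nec.
  by move=> c; apply: leq_trans (mb c) _; rewrite geq_max m2.
- by rewrite cardsU1 nfF (cardsD1 e F) eF.
- rewrite imsetU1 !inE negb_or nec andbT; apply: contra nf => /eqP<-.
  exact: imset_f.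
Qed.

(** * Alternating chains and the bound on the order *)

Section Chain.
Variable E : {set {set T}}.
Hypothesis vE : valid E.
Hypothesis maxE : forall F, valid F -> #|F| <= #|E|.

(** Since [F] already has [m] colours, [f] cannot bring a new one; as its colour occurs at most once
    in [F], the matching [f |: F] would be valid and larger than [E]. *)
Lemma no_extension F f : valid F -> #|F| = #|E| -> f \in H ->
  [disjoint f & cover F] -> mult (col f) F <= 1 -> False.
Proof.
move=> /validP[mF cF m2] sF fH dis m1.
have [mF' nf] := is_matching_add H2 mF fH dis.
have cf := full_colour mF' cF.
suff /maxE : valid (f |: F) by rewrite cardsU1 nf sF add1n ltnn.
apply/validP; split=> //.
  by rewrite imsetU1 (setUidPr _) ?sub1set.
move=> c; rewrite mult_add //; case: eqP => [<-|_]; last exact: m2.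
by rewrite add1n.
Qed.

(* X contains the non-freed ends of the edges of A, one for each edge; Z is the
   set of processed vertices outside E. *)
Definition rerouted A (X Z : {set T}) e F :=
  [/\ valid F, #|F| = #|E|, col e \notin col @: F,
      {in e, forall y, y \notin X -> y \notin cover F} &
      [/\ cover F \subset cover E :|: Z, E :\: A \subset F &
      forall c, mult c F <= maxn 1 (mult c E)]].

Definition chain A (X Z : {set T}) :=
  [/\ A \subset E, {in A & E, forall e f, col f = col e -> f = e},
      #|X| <= #|A|, #|Z| = #|A| &
      [disjoint Z & cover E] /\ {in A, forall e, exists F, rerouted A X Z e F}].

Lemma chain_size A X Z : chain A X Z ->
  #|Z| <= #|[set e in E | mult (col e) E <= 1]|.
Proof.
move=> [sA u _ -> _]; apply/subset_leq_card/subsetP=> e eA.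
have eE := subsetP sA _ eA.
by rewrite inE eE (mult_uniq eE) // => f fE /u->.
Qed.

(** A count of colours at [w]: there are more than [m], of which at most [m - #|A|] occur on
    [E :\: A] and at most [#|A|] belong to pairs joining [w] to [X]. *)
Lemma chain_edge A X Z w : chain A X Z ->
  exists f u, [/\ f \in H, f = [set w; u], u \notin X, w != u &
     col f \notin col @: (E :\: A)].
Proof.
move=> [sA uA cX _ _]; have /validP[_ cE _] := vE.
pose D := col @: [set e in H | w \in e].
have cA : #|col @: A| = #|A|.
  by rewrite card_in_imset // => e f eA fA /esym/uA ->; rewrite ?(subsetP sA).
have dA : col @: A :&: col @: (E :\: A) = set0.
  apply/setP=> c; rewrite !inE; apply/negP=> /andP[/imsetP[e eA ->]].
  case/imsetP=> f /setDP[fE fA] h; case/negP: fA.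
  by rewrite (uA e f).
have : #|A| + #|col @: (E :\: A)| = m.
  rewrite -cA -cE -[in RHS](setID E A) (setIidPr sA) imsetU cardsU dA cards0.
  by rewrite subn0.
move=> cm; set B := col @: (E :\: A).
pose P := col @: [set [set w; u] | u in X].
have cP : #|P| <= #|A|.
  by apply: leq_trans cX; do 2! (apply: leq_trans (leq_imset_card _ _) _).
have [c] : exists c, c \in D :\: (B :|: P).
  apply/set0Pn; rewrite -card_gt0 cardsD; have := deg w; rewrite /cdeg -/D.
  have := subset_leq_card (subsetIr D (B :|: P)); rewrite cardsU /B; lia.
case/setDP=> /imsetP[f]; rewrite !inE negb_or => /andP[fH wf] -> /andP[cB cnP].
have [u uw def] := edge_pair H2 fH wf.
have uX : u \notin X by apply: contra cnP => uX; rewrite def; do 2! apply: imset_f.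
by exists f, u; split=> //; rewrite eq_sym.
Qed.

Lemma chain_step A X Z w : chain A X Z -> w \notin cover E -> w \notin Z ->
  exists e u, chain (e |: A) (u |: X) (w |: Z).
Proof.
move=> chA wE wZ; have [f [u [fH def uX wu cf]]] := chain_edge w chA.
have [sA uA cX cZ [dZ rA]] := chA; have /validP[mE _ _] := vE.
(* Rerouted matchings cover only vertices of [cover E] and processed vertices, so [w] is still free
   in each of them. *)
have wR e F : rerouted A X Z e F -> w \notin cover F.
  move=> [_ _ _ _ [/subsetP/(_ w) s _ _]]; apply/negP=> /s.
  by rewrite inE (negPf wE) (negPf wZ).
have mf : mult (col f) E <= 1.
  case: (boolP (col f \in col @: E)) => [/imsetP[e eE ce]|]; last by rewrite -mult_eq0 => /eqP->.
  case: (boolP (e \in A)) => eA.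
    by rewrite ce (mult_uniq eE) // => g gE /uA->.
  by case/negP: cf; rewrite ce imset_f // inE eA.
(* If the colour of [f] occurs in [E], it is that of an edge of [A], and rerouting that edge removes
   the colour; otherwise [E] itself serves as [F]. *)
have [F [vF sF nF wF [cF EF mF]]] : exists F, [/\ valid F, #|F| = #|E|,
    col f \notin col @: F, w \notin cover F &
    [/\ cover F \subset cover E :|: Z, E :\: A \subset F &
      forall c, mult c F <= maxn 1 (mult c E)]].
  case: (boolP (col f \in col @: E)) => [/imsetP[e eE ce]|nE].
    have eA : e \in A.
      apply: contraNT cf => eA; by rewrite ce imset_f // inE eA.
    have [F R] := rA _ eA; have wF := wR _ _ R.
    by case: R => ? ? ? _ ?; exists F; rewrite ce.
  exists E; split=> //; split; rewrite ?subsetUl ?subsetDl // => c.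
  exact: leq_maxr.
(* A matching as large as [E] that misses both [w] and [u] could be extended by [f]. *)
have stuck F0 : valid F0 -> #|F0| = #|E| -> (forall c, mult c F0 <= maxn 1 (mult c E)) ->
    w \notin cover F0 -> u \in cover F0.
  move=> v0 s0 m0 w0; apply: contraT => u0; exfalso.
  apply: (no_extension v0 s0 fH); first by rewrite def disjoint_pair.
  by apply: leq_trans (m0 _) _; rewrite geq_max mf.
have /bigcupP[e eE ue] : u \in cover E.
  by apply: stuck => // c; exact: leq_maxr.
(* If [e] were in [A], then [u], lying outside [X], would be its freed end, and rerouting [e] would
   contradict [stuck]. *)
case: (boolP (e \in A)) => eA.
  have [F0 R] := rA _ eA; have w0 := wR _ _ R.
  case: R => v0 s0 _ y0 [_ _ m0].
  by case/negP: (y0 _ ue uX); apply: stuck.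
have eF : e \in F by rewrite (subsetP EF) // inE eA.
have [] := exchange vF eF fH def ue wF nF; set F' := _ |: _ => vF' sF' cF' mF'.
(* Every edge of [E :\: A] other than [e] survives in [F'], which has lost the colour of [e]; edges
   of [A] share their colour with no other edge of [E]. *)
have uniqe : {in E, forall g, col g = col e -> g = e}.
  move=> g gE cg; apply/eqP; apply: contraNT cF' => ge.
  have gA : g \notin A.
    by apply: contra ge => gA; rewrite (uA g e gA eE (esym cg)).
  by rewrite -cg imset_f // !inE ge (subsetP EF) ?orbT // inE gA.
exists e, u; split.
- by rewrite subUset sub1set eE.
- move=> g h /setU1P[->|gA] hE; first exact: uniqe.
  exact: uA.
- by rewrite !cardsU1 uX eA leq_add2l.
- by rewrite !cardsU1 wZ eA cZ.
- split.
    rewrite -setI_eq0 setIUl setU_eq0 !setI_eq0 dZ andbT.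
    by rewrite disjoints1.
move=> g /setU1P[->|gA]; last first.
  have [F0 [v0 s0 c0 y0 [cv0 E0 m0]]] := rA _ gA.
  exists F0; split=> //.
    by move=> y yg; rewrite inE negb_or => /andP[_]; apply: y0.
  split=> //.
    by apply: subset_trans cv0 _; rewrite setUS // subsetUr.
  by apply: subset_trans E0; rewrite setDS // subsetUr.
have /validP[mFF _ _] := vF.
have wcover : w \notin e by apply: contra wE => we; apply/bigcupP; exists e.
(* In [F'] the end [u] of [e] is covered by [f], which is why [u] joins [X]; the other end becomes
   free. *)
exists F'; split=> //; first by rewrite sF'.
- move=> y ye; rewrite inE in_set1 negb_or => /andP[yu _].
  have yf : y \notin f.
    rewrite def !inE (negPf yu) orbF; by apply: contra wcover => /eqP<-.
  apply/negP=> /bigcupP[h /setU1P[->|hF] yh]; first by rewrite yh in yf.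
  case/negP: (cover_D1 mFF eF ye); by apply/bigcupP; exists h.
- split.
  + apply/bigcupsP=> h /setU1P[->|/setD1P[_ hF]].
      apply/subsetP=> z; rewrite def !inE => /orP[]/eqP->; rewrite ?eqxx ?orbT //.
      by apply/orP; left; apply/bigcupP; exists e.
    apply: subset_trans (subset_trans cF _); first exact: bigcup_sup.
    by rewrite setUS // subsetUr.
  + apply/subsetP=> h; rewrite !inE negb_or -andbA => /and3P[he hA hE].
    by rewrite he (subsetP EF) ?orbT // inE hA.
  + move=> c; apply: leq_trans (mF' c) _; rewrite geq_max leq_maxl /=; exact: mF.
Qed.

Lemma chain_exists i : i <= #|~: cover E| -> exists A X Z, chain A X Z /\ #|Z| = i.
Proof.
elim: i => [_|i IH lt].
  exists set0, set0, set0; rewrite cards0; split=> //; split; rewrite ?cards0 ?sub0set //.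
  - by move=> e f; rewrite inE.
  - by split=> [|e]; rewrite ?inE // -setI_eq0 set0I.
have [A [X [Z [ch cZ]]]] := IH (ltnW lt).
have [w] : exists w, w \in ~: cover E :\: Z.
  by apply/set0Pn; rewrite -card_gt0; have := cardsID Z (~: cover E);
     have := subset_leq_card (subsetIr (~: cover E) Z); lia.
rewrite !inE => /andP[wZ wE].
have [e [u ch']] := chain_step ch wE wZ.
by exists (e |: A), (u |: X), (w |: Z); split=> //; rewrite cardsU1 wZ cZ.
Qed.

(** A chain that has processed every uncovered vertex has spent on each of them a different edge
    whose colour occurs once. *)
Lemma uncovered_le : #|~: cover E| <= #|[set e in E | mult (col e) E <= 1]|.
Proof.
by have [A [X [Z [/chain_size h <-]]]] := chain_exists (leqnn _).
Qed.

(** With [s] colours used once and the other [m - s] at most twice, [#|E|] is at most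
    [s + 2 * (m - s)]. *)
Lemma card_valid_le :
  #|E| + #|[set e in E | mult (col e) E <= 1]| <= 2 * m.
Proof.
have /validP[_ cE m2] := vE.
set S := [set e in E | _].
have sS : S \subset E by apply/subsetP=> e; rewrite inE => /andP[].
have u e f : e \in S -> f \in E -> col f = col e -> f = e.
  rewrite inE => /andP[eE m1] fE cfe; apply/eqP; apply: contraTT m1 => nfe.
  rewrite -ltnNge; have <- : #|[set f; e]| = 2 by rewrite cards2 nfe.
  by apply/subset_leq_card/subsetP=> h; rewrite !inE => /orP[]/eqP->;
    rewrite ?eE ?fE ?cfe eqxx.
have cS : #|col @: S| = #|S|.
  rewrite card_in_imset // => e f eS fS h.
  by apply: u => //; apply: (subsetP sS).
have dS : col @: S :&: col @: (E :\: S) = set0.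
  apply/setP=> c; rewrite [RHS]inE; apply/negP=> /setIP[/imsetP[e eS ->]].
  by case/imsetP=> f /setDP[fE fS] h; case/negP: fS; rewrite (u e f).
have cm : #|S| + #|col @: (E :\: S)| = m.
  rewrite -cS -cE -[in RHS](setID E S) (setIidPr sS) imsetU cardsU dS cards0.
  by rewrite subn0.
have h : #|E :\: S| <= 2 * #|col @: (E :\: S)|.
  by apply: card_le_mult => c; apply: leq_trans (m2 c); rewrite mult_sub ?subsetDl.
have := cardsID S E; rewrite (setIidPr sS); lia.
Qed.

(** The order is [2 * #|E|] plus the number of uncovered vertices, hence at most
    [2 * (2 * m - s) + s] in the same notation. *)
Lemma order_le : #|T| + #|[set e in E | mult (col e) E <= 1]| <= 4 * m.
Proof.
have /validP[mE _ _] := vE.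
have cc : #|cover E| = 2 * #|E|.
  have /andP[_ /eqP<-] := mE; rewrite mulnC -sum_nat_const.
  by apply: eq_bigr => e /(is_matching_edge mE)/H2.
have := cardsC (cover E); have := uncovered_le; have := card_valid_le.
rewrite cc; lia.
Qed.

(** * The extremal case of order [4 * m] *)

Definition paired F := [/\ is_matching F, #|col @: F| = m, cover F = setT &
  {in F, forall e, exists e', [/\ e' \in F, e' != e & col e' = col e]}].

Lemma paired_max : 4 * m <= #|T| -> paired E.
Proof.
move=> le; have /validP[mE cE _] := vE; have oE := order_le.
have S0 : #|[set e in E | mult (col e) E <= 1]| = 0 by lia.
split=> //.
  have /eqP : #|~: cover E| = 0 by apply/eqP; rewrite -leqn0 -S0; exact: uncovered_le.
  by rewrite cards_eq0 => /eqP h; rewrite -(setCK (cover E)) h setC0.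
move=> e eE; have /eqP := S0; rewrite cards_eq0 => /eqP/setP/(_ e).
rewrite !inE eE /= => /negbT; rewrite -ltnNge /mult (cardsD1 e) !inE eE eqxx ltnS.
case/card_gt0P=> e'; rewrite !inE => /andP[ne /andP[eE' /eqP ce]].
by exists e'.
Qed.

End Chain.
(** If the edges of [F] at [u] and [v] had different colours, both could be deleted without losing a
    colour, as each has a partner; adding [f] would then give [m + 1] colours. *)
Lemma paired_new_edge F f u v : paired F -> f \in H -> f = [set u; v] ->
  col f \notin col @: F ->
  exists e1 e2, [/\ e1 \in F, e2 \in F, u \in e1, v \in e2 & col e1 = col e2].
Proof.
move=> [mF cF /setP covF pF] fH def nf.
have /bigcupP[e1 e1F ue] : u \in cover F by rewrite covF.
have /bigcupP[e2 e2F ve] : v \in cover F by rewrite covF.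
exists e1, e2; split=> //; apply/eqP; apply: contraT => ne.
pose F1 := F :\ e1 :\ e2.
have sF1 : F1 \subset F by rewrite (subset_trans (subD1set _ _)) ?subD1set.
have mF1 : is_matching F1 by exact: is_matching_sub mF.
have ncov x : x \in e1 :|: e2 -> x \notin cover F1.
  move=> xe; apply/negP=> /bigcupP[g]; rewrite !inE => /and3P[g2 g1 gF] xg.
  case/setUP: xe => xe; first by rewrite (is_matching_uniq mF e1F gF xe xg) eqxx in g1.
  by rewrite (is_matching_uniq mF e2F gF xe xg) eqxx in g2.
have [mF2 _] : is_matching (f |: F1) /\ f \notin F1.
  by apply: is_matching_add => //; rewrite def disjoint_pair ?ncov ?inE ?ue ?ve ?orbT.
have := few mF2; rewrite imsetU1 cardsU1.
have -> : col @: F1 = col @: F.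
  apply/eqP; rewrite eqEsubset imsetS //=; apply/subsetP=> c /imsetP[g gF ->].
  case: (eqVneq g e1) => [->|g1].
    have [e [eF e_ne ce]] := pF _ e1F.
    rewrite -ce imset_f // !inE e_ne eF !andbT.
    by apply: contra ne => /eqP<-; rewrite ce.
  case: (eqVneq g e2) => [->|g2]; last by rewrite imset_f // !inE g1 g2.
  have [e [eF e_ne ce]] := pF _ e2F.
  rewrite -ce imset_f // !inE e_ne eF !andbT /=.
  by apply: contra ne => /eqP<-; rewrite ce.
by rewrite nf cF ltnn.
Qed.

Section Extremal.
Variable E : {set {set T}}.
Hypothesis pE : paired E.
Hypothesis m2 : forall c, mult c E <= 2.

Lemma partner_uniq e e' g : e \in E -> e' \in E -> g \in E -> e' != e ->
  col e' = col e -> col g = col e -> g = e \/ g = e'.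
Proof.
move=> eE e'E gE ne ce cg; case: (eqVneq g e) => [|g1]; first by left.
case: (eqVneq g e') => [|g2]; first by right.
have := m2 (col e); rewrite leqNgt => /negP[].
have <- : #|[set g; e'; e]| = 3 by rewrite setUC cardsU1 cards2 !inE negb_or g2 eq_sym g1 eq_sym ne.
apply/subset_leq_card/subsetP=> h; rewrite !inE -orbA => /or3P[]/eqP->.
- by rewrite gE cg /=.
- by rewrite e'E ce /=.
- by rewrite eE /=.
Qed.

(** Some colour at [u] is absent from [E]. By [paired_new_edge] its edge ends in [e] or [e']; in the
    first case it would be [e] itself, whose colour is present. *)
Lemma new_edge_across e e' u : e \in E -> e' \in E -> e' != e ->
  col e' = col e -> u \in e ->
  exists2 v, v \in e' & ([set u; v] \in H) && (col [set u; v] \notin col @: E).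
Proof.
move=> eE e'E ne ce ue; have [mE cE _ _] := pE.
have [c] : exists c, c \in col @: [set f in H | u \in f] :\: col @: E.
  apply/set0Pn; rewrite -card_gt0 cardsD; have := deg u; rewrite /cdeg.
  set D := col @: [set f in H | _]; have := subset_leq_card (subsetIr D (col @: E)).
  rewrite cE; lia.
case/setDP=> /imsetP[f]; rewrite inE => /andP[fH uf] -> nf.
have [v vu def] := edge_pair H2 fH uf.
have [e1 [e2 [e1E e2E ue1 ve2 c12]]] := paired_new_edge pE fH def nf.
have e1e : e1 = e by apply: is_matching_uniq mE e1E eE ue1 ue.
subst e1; exists v; last by rewrite -def fH.
have [e2e|<-//] := partner_uniq eE e'E e2E ne ce (esym c12).
subst e2; case/negP: nf; suff -> : f = e by apply: imset_f.
apply/eqP; rewrite eqEcard (H2 fH) (H2 (is_matching_edge mE eE)) leqnn andbT def.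
by rewrite subUset !sub1set ue ve2.
Qed.

(** New edges leave both ends of [e]. If they meet at the same end [p] of [e'], the new edge from
    the other end [q] is disjoint from one of them. *)
Lemma new_square e e' : e \in E -> e' \in E -> e' != e -> col e' = col e ->
  exists x y p q, [/\ e = [set x; y], e' = [set p; q], x != y & p != q] /\
    [/\ [set x; p] \in H, col [set x; p] \notin col @: E,
        [set y; q] \in H & col [set y; q] \notin col @: E].
Proof.
move=> eE e'E ne ce; have [mE _ _ _] := pE.
have ne' : e != e' by rewrite eq_sym.
have /H2/eqP/cards2P[x [y [xy de]]] := is_matching_edge mE eE.
have xe : x \in e by rewrite de !inE eqxx.
have ye : y \in e by rewrite de !inE eqxx orbT.
have [p pe' /andP[xpH xpN]] := new_edge_across eE e'E ne ce xe.
have [q qp de'] := edge_pair H2 (is_matching_edge mE e'E) pe'.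
have qe' : q \in e' by rewrite de' !inE eqxx orbT.
have pq : p != q by rewrite eq_sym.
have yx : y != x by rewrite eq_sym.
have de2 : e = [set y; x] by rewrite setUC.
have [r re' /andP[yrH yrN]] := new_edge_across eE e'E ne ce ye.
have [s se /andP[qsH qsN]] := new_edge_across e'E eE ne' (esym ce) qe'.
rewrite de' !inE in re'; case/orP: re' => /eqP rE; subst r; last by exists x, y, p, q.
rewrite de !inE in se; case/orP: se => /eqP sE; subst s; rewrite setUC in qsH qsN.
  have de2' : e' = [set q; p] by rewrite setUC.
  by exists x, y, q, p.
by exists x, y, p, q.
Qed.

(* The last property says that F induces on the vertices the same quadruples
   as E. *)
Lemma recoloured e : e \in E -> exists F, [/\ paired F, col e \notin col @: F &
  {in F &, forall h1 h2 u v, col h1 = col h2 -> u \in h1 -> v \in h2 ->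
    exists e1 e2, [/\ e1 \in E, e2 \in E, u \in e1, v \in e2 & col e1 = col e2]}].
Proof.
move=> eE; have [mE cE /setP covE partE] := pE.
have [e' [e'E ne ce]] := partE _ eE.
have [x [y [p [q [[de de' xy pq] []]]]]] := new_square eE e'E ne ce.
set g := [set x; p]; set g' := [set y; q] => gH gN g'H g'N.
pose E1 := E :\ e :\ e'; pose F := g |: (g' |: E1).
have sE1 : E1 \subset E by rewrite (subset_trans (subD1set _ _)) ?subD1set.
have mE1 : is_matching E1 by exact: is_matching_sub mE.
have xe : x \in e by rewrite de !inE eqxx.
have ye : y \in e by rewrite de !inE eqxx orbT.
have pe : p \in e' by rewrite de' !inE eqxx.
have qe : q \in e' by rewrite de' !inE eqxx orbT.
have dee z t : z \in e -> t \in e' -> z != t.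
  move=> ze te; apply: contraNneq ne => zt; rewrite -zt in te.
  by rewrite (is_matching_uniq mE e'E eE te ze).
have ncov z : z \in e :|: e' -> z \notin cover E1.
  move=> ze; apply/negP=> /bigcupP[h]; rewrite !inE => /and3P[h2 h1 hE] zh.
  case/setUP: ze => ze; first by rewrite (is_matching_uniq mE eE hE ze zh) eqxx in h1.
  by rewrite (is_matching_uniq mE e'E hE ze zh) eqxx in h2.
have [mF1 _] : is_matching (g' |: E1) /\ g' \notin E1.
  by apply: is_matching_add => //; rewrite disjoint_pair // ncov // inE ?ye ?qe ?orbT.
have ncov' z : z \in e :|: e' -> z \notin g' -> z \notin cover (g' |: E1).
  move=> ze zg; apply/negP=> /bigcupP[h /setU1P[->|hE] zh]; first by rewrite zh in zg.
  by case/negP: (ncov z ze); apply/bigcupP; exists h.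
have xg : x \notin g' by rewrite !inE negb_or xy dee.
have pg : p \notin g' by rewrite !inE negb_or pq eq_sym dee.
have [mF _] : is_matching F /\ g \notin g' |: E1.
  by apply: is_matching_add => //; rewrite disjoint_pair // ncov' // inE ?xe ?pe ?orbT.
have ce1 : col e \notin col @: E1.
  apply/imsetP=> -[h]; rewrite !inE => /and3P[h2 h1 hE] ch.
  have [hh|hh] := partner_uniq eE e'E hE ne ce (esym ch).
    by rewrite hh eqxx in h1.
  by rewrite hh eqxx in h2.
have cE1 : #|col @: E1|.+1 = m.
  rewrite -cE; have -> : col @: E = col e |: col @: E1.
    apply/setP=> c; rewrite !inE; apply/imsetP/orP=> [[h hE ->]|[/eqP->|/imsetP[h hE ->]]].
    - case: (eqVneq h e) => [->|h1]; first by left.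
      case: (eqVneq h e') => [->|h2]; first by left; rewrite ce.
      by right; rewrite imset_f // !inE h1 h2.
    - by exists e.
    - by exists h => //; rewrite (subsetP sE1).
  by rewrite cardsU1 ce1.
have nE1 f : col f \notin col @: E -> col f \notin col @: E1.
  by apply: contra; apply: subsetP (imsetS _ _) _.
(* Two different new colours, together with the [m - 1] colours of [E1], would exceed [m]. *)
have cgg : col g = col g'.
  have := few mF; rewrite !imsetU1 !cardsU1 (nE1 g') // !inE (negPf (nE1 g gN)) orbF.
  by case: eqP => //= _; rewrite -cE1 !add1n ltnn.
have cF : col @: F = col g |: col @: E1 by rewrite !imsetU1 cgg setUA setUid.
have gg : g' != g by apply: contraNneq xg => ->; rewrite !inE eqxx.
exists F; split.
- split=> //.
  + by rewrite cF cardsU1 nE1.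
  + apply/setP=> z; rewrite [RHS]inE; have := covE z; rewrite [in RHS]inE => /bigcupP[h hE zh].
    have inF h' : h' \in F -> z \in h' -> z \in cover F.
      by move=> ? ?; apply/bigcupP; exists h'.
    have gF : g \in F by rewrite !inE eqxx.
    have gF' : g' \in F by rewrite !inE eqxx orbT.
    case: (eqVneq h e) => [he|h1].
      move: zh; rewrite he de !inE => /orP[]/eqP zz.
        by apply: inF gF _; rewrite zz !inE eqxx.
      by apply: inF gF' _; rewrite zz !inE eqxx.
    case: (eqVneq h e') => [he|h2].
      move: zh; rewrite he de' !inE => /orP[]/eqP zz.
        by apply: inF gF _; rewrite zz !inE eqxx orbT.
      by apply: inF gF' _; rewrite zz !inE eqxx orbT.
    by apply: (inF h) => //; rewrite !inE h1 h2 hE !orbT.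
  + move=> h /setU1P[->|/setU1P[->|hE]].
    * by exists g'; rewrite !inE eqxx orbT cgg.
    * by exists g; rewrite !inE eqxx eq_sym cgg.
    * have [h' [h'E nh ch]] := partE _ (subsetP sE1 _ hE).
      have chE : col h' \in col @: E1 by rewrite ch imset_f.
      exists h'; split=> //; rewrite !inE h'E andbT; apply/orP; right; apply/orP; right.
      apply/andP; split; apply: contraNneq ce1 => h'e; first by rewrite -ce -h'e.
      by rewrite -h'e.
- rewrite cF !inE negb_or ce1 andbT; apply: contraNneq gN => <-; exact: imset_f.
have gz z : (z \in g) || (z \in g') -> exists e1, [/\ e1 \in E, z \in e1 & col e1 = col e].
  rewrite !inE -!orbA => /or4P[]/eqP->; [exists e|exists e'|exists e|exists e'] => //.
have FE h : h \in F -> (h = g \/ h = g') /\ col h = col g \/ h \in E1 /\ col h != col g.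
  case/setU1P=> [->|/setU1P[->|hE]]; [by left; split; [left|]|by left; split; [right|]|right].
  split=> //; apply: contraNneq (nE1 g gN) => <-; exact: imset_f.
move=> h1 h2 /FE[[h1g c1]|[h1E c1]] /FE[[h2g c2]|[h2E c2]] u v ch uh vh.
- have [|e1 [e1E ue1 ce1']] := gz u; first by case: h1g => <-; rewrite uh ?orbT.
  have [|e2 [e2E ve2 ce2]] := gz v; first by case: h2g => <-; rewrite vh ?orbT.
  by exists e1, e2; rewrite ce1' ce2.
- by rewrite -ch c1 eqxx in c2.
- by rewrite ch c2 eqxx in c1.
- by exists h1, h2; split=> //; apply: (subsetP sE1).
Qed.

(** An edge with a new colour is handled by [paired_new_edge]; otherwise [recoloured] supplies a
    matching in which its colour is new and which has the same quadruples. *)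
Lemma edge_local f u v : f \in H -> f = [set u; v] ->
  exists e1 e2, [/\ e1 \in E, e2 \in E, u \in e1, v \in e2 & col e1 = col e2].
Proof.
move=> fH def; case: (boolP (col f \in col @: E)) => [/imsetP[e eE ce]|]; last first.
  exact: paired_new_edge.
have [F [pF nF loc]] := recoloured eE; rewrite -ce in nF.
have [h1 [h2 [? ? ? ? ?]]] := paired_new_edge pF fH def nF.
exact: (loc h1 h2).
Qed.

(** All neighbours of [u] are among the three other vertices of its quadruple, so [u] sees at most
    three colours, yet it sees more than [m]. *)
Lemma extremal_degree (u : T) : m < 3.
Proof.
have [mE _ /setP covE partE] := pE.
have /bigcupP[e eE ue] : u \in cover E by rewrite covE.
have [e' [e'E ne ce]] := partE _ eE.
apply: leq_trans (deg u) _; apply: leq_trans (leq_imset_card _ _) _.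
have : #|(e :|: e') :\ u| <= 3.
  have := cardsD1 u (e :|: e'); rewrite inE ue /= cardsU.
  rewrite (H2 (is_matching_edge mE eE)) (H2 (is_matching_edge mE e'E)); lia.
apply: leq_trans; apply: leq_trans (leq_imset_card (fun v => [set u; v]) _).
apply/subset_leq_card/subsetP=> f; rewrite inE => /andP[fH uf].
have [v vu def] := edge_pair H2 fH uf;
rewrite [X in X \in _]def; apply: (imset_f (fun v => [set u; v])).
have [e1 [e2 [e1E e2E ue1 ve2 c12]]] := edge_local fH def.
have e1e : e1 = e by apply: is_matching_uniq mE e1E eE ue1 ue.
rewrite !inE vu /=; rewrite e1e in c12.
by have [<-|<-] := partner_uniq eE e'E e2E ne ce (esym c12); rewrite ve2 ?orbT.
Qed.

End Extremal.

(** * Induction on [k] and return to the edge-coloured graph *)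

Lemma valid_order F0 : valid F0 ->
  #|T| <= 4 * m /\ (4 * m <= #|T| -> 0 < #|T| -> m < 3).
Proof.
move=> v0; case: (@arg_maxnP _ F0 valid (fun F => #|F|) v0) => E vE maxE.
split; first by have := order_le vE maxE; lia.
move=> le /card_gt0P[u _].
have /validP[_ _ m2] := vE; exact: extremal_degree (paired_max vE maxE le) m2 u.
Qed.

End Augment.

Lemma many_colours (T K : finType) (H : {set {set T}}) (col : {set T} -> K) k :
  (forall e, e \in H -> #|e| = 2) -> (forall v, k <= cdeg H col v) ->
  4 * k - 3 <= #|T| \/ 4 <= k /\ 4 * k - 4 <= #|T| ->
  exists2 E, is_matching H E & k <= #|col @: E|.
Proof.
move=> H2; elim: k => [|m IH] deg hn.
  by exists set0 => //; rewrite /is_matching sub0set; apply/trivIsetP=> A B; rewrite inE.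
case: (boolP [exists E, is_matching H E && (m < #|col @: E|)]) => [/existsP[E /andP[]]|].
  by exists E.
rewrite negb_exists => /forallP no.
have few E : is_matching H E -> #|col @: E| <= m by have := no E; case: (is_matching H E); lia.
(* The hypothesis on the order weakens to its first alternative for [m], since [4 * m - 3] is below
   both bounds for [m + 1]. Keeping one edge for each of [m] colours then gives a valid matching. *)
have [|E0 mE0 cE0] := IH (fun v => ltnW (deg v)); first by lia.
have [F [sF iF cF]] := rainbow_sub cE0.
have vF : valid H col m F.
  apply/validP; split; [exact: is_matching_sub mE0|by rewrite card_in_imset|].
  move=> c; case: (boolP (c \in col @: F)) => [/imsetP[e eF ->]|]; last first.
    by rewrite -mult_eq0 => /eqP->.
  by rewrite mult_uniq // => f fF; apply: iF.
(* For [k = m + 1] the first alternative reads [4 * m + 1 <= #|T|], against the order bound; the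
   second gives [4 * m <= #|T|] with [m >= 3], against the extremal case. *)
have [] := valid_order H2 few deg vF; lia.
Qed.

Lemma bigminn_le (I : eqType) (r : seq I) x (F : I -> nat) i :
  i \in r -> \big[minn/x]_(j <- r) F j <= F i.
Proof.
elim: r => // j r IH; rewrite inE big_cons => /orP[/eqP->|/IH]; first exact: geq_minl.
by apply: leq_trans; exact: geq_minr.
Qed.

Theorem theorem1 (k n : nat) (T : finType) (C : eqType) (G : ecgraph T C)
    (hk : 1 <= k) (hn : #|T| = n) (hG : k <= min_colour_degree G)
    (hkn : (4 <= k /\ 4 * k - 4 <= n) \/ (k <= 3 /\ 4 * k - 3 <= n)) :
  exists M : {set {set T}}, [/\ matching G M, rainbow G M & #|M| = k].
Proof.
(* [C] need not be finite, so a colour is replaced by its fibre in [{set {set T}}]. *)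
pose fibre c := [set f : {set T} | colour G f == c].
pose col f := fibre (colour G f).
have colE e f : col e = col f -> colour G e = colour G f.
  by move/setP/(_ e); rewrite !inE eqxx => /esym/eqP.
have deg v : k <= cdeg (edges G) col v.
  apply: leq_trans hG _; apply: leq_trans (bigminn_le _ _ (mem_index_enum v)) _.
  rewrite /colour_degree /colours_at; set s := undup _.
  have sP c : c \in s -> exists2 e, e \in [set e in edges G | v \in e] & c = colour G e.
    rewrite mem_undup => /mapP[e]; rewrite mem_filter mem_enum => /andP[ve eG] ->.
    by exists e; rewrite ?inE ?eG.
  have us : uniq (map fibre s).
    rewrite map_inj_in_uniq ?undup_uniq // => c d /sP[e _ ->] /sP[f _ ->]; exact: colE.
  rewrite -(size_map fibre) -(card_uniqP us); apply/subset_leq_card/subsetP=> c.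
  by case/mapP=> d /sP[e eG ->] ->; apply: imset_f.
have [||E /andP[sE tE] kE] := @many_colours T _ (edges G) col k _ deg.
- exact: edges_card2.
- rewrite hn; lia.
have [M [sM iM cM]] := rainbow_sub kE.
exists M; split=> //; first by split; [exact: subset_trans sE|exact: trivIsetS tE].
by move=> e f eM fM ce; apply: iM => //; rewrite /col ce.
Qed.
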